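(* Let $0<\alpha<1$. There exist a bounded sequence $\{v_j\}_{j\in\mathbb Z}$, a $\rho$-lacunary sequence $\{a_j\}_{j\in\mathbb Z}$ of positive numbers (for some $\rho>1$) and a function $f\in L^\infty(\mathbb R)$ such that $T^*f(t)=\infty$ for all $t\in\mathbb R$.
   Context: For $0<\alpha<1$, $\tau>0$, $t\in\mathbb R$, $$\mathcal P_\tau^\alpha f(t)=\frac{1}{4^\alpha\Gamma(\alpha)}\int_0^{\infty}\frac{\tau^{2\alpha}e^{-\tau^2/(4s)}}{s^{1+\alpha}}f(t-s)\,ds.$$ A sequence $\{a_j\}_{j\in\mathbb Z}$ of positive numbers is $\rho$-lacunary ($\rho>1$) if $a_{j+1}/a_j\ge\rho$ for all $j\in\mathbb Z$. For $N=(N_1,N_2)\in\mathbb Z^2$ with $N_1<N_2$, $$T_N^\alpha f(t)=\sum_{j=N_1}^{N_2}v_j\big(\mathcal P_{a_{j+1}}^\alpha f(t)-\mathcal P_{a_j}^\alpha f(t)\big),$$ and $T^*f(t)=\sup_N|T_N^\alpha f(t)|$, the supremum being over all $N=(N_1,N_2)\in\mathbb Z^2$ with $N_1<N_2$. *)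

(* Defs.v *)
From HB Require Import structures.
From mathcomp Require Import all_boot all_order all_algebra.
From mathcomp Require Import all_classical all_reals all_analysis.

Set Implicit Arguments.
Unset Strict Implicit.
Unset Printing Implicit Defensive.

Import Order.TTheory GRing.Theory Num.Theory.
Import numFieldNormedType.Exports.

Local Open Scope classical_set_scope.
Local Open Scope ring_scope.

Definition Gamma (R : realType) (z : R) : R :=
  \int[lebesgue_measure]_(x in `]0%R, +oo[) (x `^ (z - 1) * expR (- x)).

(* Only meaningful for 0 < tau. *)
Definition frac_poisson (R : realType) (alpha tau : R) (f : R -> R) (t : R) : R :=
  (4 `^ alpha * Gamma alpha)^-1 *
  \int[lebesgue_measure]_(s in `]0%R, +oo[)
    (tau `^ (2 * alpha) * expR (- (tau ^+ 2 / (4 * s))) / s `^ (1 + alpha)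
     * f (t - s)).

Definition lacunary (R : realType) (rho : R) (a : int -> R) : Prop :=
  (forall j : int, 0 < a j) /\ (forall j : int, rho <= a (j + 1) / a j).

(* With j = N.1 + k, the index j runs over all integers N.1 <= j <= N.2 as soon
   as N.1 <= N.2. *)
Definition diff_transform (R : realType) (alpha : R) (v a : int -> R)
    (N : int * int) (f : R -> R) (t : R) : R :=
  \sum_(0 <= k < `|N.2 - N.1|%N.+1)
    v (N.1 + k%:Z) *
    (frac_poisson alpha (a (N.1 + k%:Z + 1)) f t
     - frac_poisson alpha (a (N.1 + k%:Z)) f t).

Definition max_diff_transform (R : realType) (alpha : R) (v a : int -> R)
    (f : R -> R) (t : R) : \bar R :=
  ereal_sup [set (`|diff_transform alpha v a N f t|)%:E
            | N in [set N : int * int | N.1 < N.2]].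

(* Main.v *)
Require Import Defs.
From mathcomp Require Import all_boot all_order all_algebra.
From mathcomp Require Import all_classical all_reals all_analysis.
From mathcomp Require Import measurable_realfun ess_sup_inf.
From mathcomp Require Import ring lra.
Import Order.TTheory GRing.Theory Num.Theory.
Import numFieldNormedType.Exports.
Local Open Scope classical_set_scope.
Local Open Scope ring_scope.

(** The kernel of the operator at scale tau lives at s of order tau ^ 2: it
carries at least the fixed mass c0 = e^(-1/4) / 4 on [tau^2, 2 tau^2]
([poisson_kernel_ge]), while its mass on ]0, x tau^2], for x <= 1, is O(x) and
its mass beyond y tau^2 is O(y^(-alpha)), uniformly in tau ([kernel_integral_le]).

Hence, if the ratio r of the geometric sequence a_j = r^j is large enough
([exists_large_ratio]), the operators at scales a_j and a_(j+1) look at almost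
disjoint zones of the past of t. Let f be the indicator function of the union
of blocks placed at distance about a_j^2 to the left of the origin, for the
even naturals j. Up to the common factor C = 1 / (4^alpha Gamma(alpha)), the
operator at scale a_j applied to f is at least c0 when j is even
([poisson_blocks_even]) and at most c0 / 2 when j is odd
([poisson_blocks_odd]). Seen from an arbitrary t the blocks are shifted by t,
which becomes negligible compared with a_j^2, so these bounds hold for every t
and all j >= J(t). With v_j = (-1)^(j+1), each term with j >= J(t) is then at
least C c0 / 2, and the sums from J(t) to J(t) + n tend to infinity with n.

The constant C has to be a positive real, which requires the integral defining
Gamma(alpha) to be finite and positive ([Gamma_gt0]). *)

(** * Pointwise bounds on the kernel *)

Definition poisson_kernel {R : realType} (alpha tau s : R) : R :=
  tau `^ (2 * alpha) * expR (- (tau ^+ 2 / (4 * s))) / s `^ (1 + alpha).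

Section kernel.
Context {R : realType} (alpha : R).
Implicit Types tau s : R.
Local Notation K := (poisson_kernel alpha).

Lemma poisson_kernel_ge0 tau s : 0 <= K tau s.
Proof. by rewrite /poisson_kernel mulr_ge0 ?invr_ge0 ?mulr_ge0 ?powR_ge0 ?expR_ge0. Qed.

Lemma measurable_poisson_kernel tau : measurable_fun (`]0, +oo[ : set R) (K tau).
Proof.
apply: (@eq_measurable_fun _ _ _ _ _
  (fun s => tau `^ (2 * alpha) * expR ((- (tau ^+ 2 / 4)) * s `^ (-1))
     * s `^ (- (1 + alpha)))).
  move=> s; rewrite inE/= in_itv/= andbT => s0.
  rewrite /poisson_kernel powRN powR_inv1 ?ltW//; congr (_ * expR _ * _).
  by field; lra.
apply: measurable_funTS.
apply: measurable_funM; last exact: measurable_powR.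
apply: measurable_funM => //.
apply: measurableT_comp => //.
apply: measurable_funM => //; exact: measurable_powR.
Qed.

(** The kernel is the dilation by tau ^ 2 of a fixed profile; this is what makes
the estimates uniform in tau. *)
Lemma poisson_kernel_scale tau s : 0 < tau -> 0 < s ->
  K tau s = (expR (- (4 * (s / tau ^+ 2))^-1) * (s / tau ^+ 2) `^ (- (1 + alpha)))
            / tau ^+ 2.
Proof.
move=> t0 s0; have t20 : 0 < tau ^+ 2 by rewrite exprn_gt0.
rewrite /poisson_kernel.
rewrite powRM ?invr_ge0 ?ltW// powRN.
have -> : (tau ^+ 2)^-1 `^ (- (1 + alpha)) = (tau ^+ 2) * tau `^ (2 * alpha).
  rewrite -powR_inv1 ?ltW// -powRrM mulN1r opprK powRD.
    by rewrite powRr1 ?ltW// -powR_mulrn ?ltW// -powRrM.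
  by rewrite (gt_eqF t20) implybT.
have -> : (4 * (s / tau ^+ 2))^-1 = tau ^+ 2 / (4 * s) by field; lra.
have ? : 0 < s `^ (1 + alpha) by rewrite powR_gt0.
by field; lra.
Qed.

(** The exponential beats the singular power at the origin: e^(-x) <= 2 / x^2
with x = 1 / (4 u) gives e^(-1/(4u)) <= 32 u^2, and u^2 absorbs u^(-1-alpha) for
u <= 1. *)
Lemma poisson_kernel_le_near tau s : alpha < 1 -> 0 < tau -> 0 < s -> s <= tau ^+ 2 ->
  K tau s <= 32 / tau ^+ 2.
Proof.
move=> alpha_lt1 t0 s0 st; have t20 : 0 < tau ^+ 2 by rewrite exprn_gt0.
have t2V : 0 < (tau ^+ 2)^-1 by rewrite invr_gt0.
rewrite poisson_kernel_scale// (ler_pM2r t2V).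
set u := s / tau ^+ 2.
have u0 : 0 < u by rewrite divr_gt0.
have u1 : u <= 1 by rewrite ler_pdivrMr// mul1r.
have hE : expR (- (4 * u)^-1) <= 32 * u ^+ 2.
  rewrite expRN -[leRHS]invrK lef_pV2 ?posrE ?expR_gt0 ?invr_gt0 ?mulr_gt0 ?exprn_gt0//.
  have x0 : 0 <= (4 * u)^-1 by rewrite invr_ge0 mulr_ge0 ?ltW.
  apply: le_trans (expR_ge1Dxn 1 x0).
  have -> : (2`!)%:R = 2 :> R by [].
  suff -> : (32 * u ^+ 2)^-1 = (4 * u)^-1 ^+ 2 / 2 by rewrite lerDr.
  by field; lra.
have hp : u `^ (- (1 + alpha)) <= u `^ (- 2).
  by apply: ger_powR; [rewrite u0 | lra].
apply: (@le_trans _ _ (32 * u ^+ 2 * u `^ (- 2))).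
  by apply: ler_pM => //; rewrite ?expR_ge0 ?powR_ge0.
by rewrite powRN powR_mulrn ?(ltW u0)// mulfK ?lexx ?lt0r_neq0 ?exprn_gt0.
Qed.

Lemma poisson_kernel_le_far tau s : 0 < s ->
  K tau s <= tau `^ (2 * alpha) * s `^ (- (1 + alpha)).
Proof.
move=> s0; rewrite /poisson_kernel powRN ler_wpM2r ?invr_ge0 ?powR_ge0//.
rewrite ler_piMr ?powR_ge0// -expR0 ler_expR oppr_le0.
by rewrite mulr_ge0 ?sqr_ge0// invr_ge0 mulr_ge0 ?ltW.
Qed.

Lemma poisson_kernel_ge tau s : alpha < 1 -> 0 < tau -> tau ^+ 2 <= s <= 2 * tau ^+ 2 ->
  expR (- 4^-1) / 4 / tau ^+ 2 <= K tau s.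
Proof.
move=> alpha_lt1 t0 /andP[st1 st2]; have t20 : 0 < tau ^+ 2 by rewrite exprn_gt0.
have s0 : 0 < s by lra.
have t2V : 0 < (tau ^+ 2)^-1 by rewrite invr_gt0.
rewrite poisson_kernel_scale// (ler_pM2r t2V).
set u := s / tau ^+ 2.
have u1 : 1 <= u by rewrite ler_pdivlMr// mul1r.
have u2 : u <= 2 by rewrite ler_pdivrMr.
have u0 : 0 < u by lra.
apply: ler_pM; rewrite ?expR_ge0 ?invr_ge0//.
  by rewrite ler_expR lerN2 lef_pV2 ?posrE; lra.
apply: (@le_trans _ _ (2 `^ (- 2))).
  by rewrite powRN powR_mulrn; [rewrite lef_pV2 ?posrE; lra|lra].
apply: (@le_trans _ _ (u `^ (- 2))); last by apply: ler_powR => //; lra.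
have u_ge0 := ltW u0.
rewrite !powRN !powR_mulrn// lef_pV2 ?posrE ?exprn_gt0//.
by rewrite lerXn2r ?nnegrE.
Qed.

End kernel.

(** * Integrals of powers and the Gamma function *)

Section integrals.
Context {R : realType}.
Local Notation mu := (@lebesgue_measure R).

Lemma integral_powR_tail (M b : R) : 0 < M -> 0 < b ->
  (\int[mu]_(s in `[M, +oo[) (s `^ (- (1 + b)))%:E = (M `^ (- b) / b)%:E)%E.
Proof.
move=> M0 b0.
pose F (s : R) := - b^-1 * s `^ (- b).
have dF (x : R) : 0 < x -> is_derive x 1 F (x `^ (- (1 + b))).
  move=> x0; have := is_derive1_powR (- b) x0 => H.
  apply: is_derive_eq.
  rewrite /GRing.scale/= mulrA mulrNN mulVf ?gt_eqF// mul1r; congr powR; lra.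
rewrite (@ge0_continuous_FTC2y _ _ F M 0).
- rewrite -EFinB; congr EFin; rewrite /F; field; lra.
- by move=> x _; exact: powR_ge0.
- apply: derivable_within_continuous => x; rewrite in_itv/= andbT => Mx.
  by apply: derivable_powR; rewrite in_itv/= andbT; lra.
- rewrite -[X in _ --> X](mulr0 (- b^-1)); apply: cvgMl_tmp.
  rewrite /=.
  apply: (@cvg_trans _ (((x^-1) `^ b) @[x --> +oo])).
    apply: near_eq_cvg; near=> x.
    have x0 : 0 < x by near: x; apply: nbhs_pinfty_gt; rewrite num_real.
    by rewrite -powR_inv1 ?ltW// -powRrM mulN1r.
  apply: (@cvg_comp _ _ _ (fun x => x^-1) (fun a => a `^ b) _ (0^'+)).
    move=> P /= [e /= e0 eP]; near=> x.
    have x0 : 0 < x by near: x; apply: nbhs_pinfty_gt; rewrite num_real.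
    have xV0 : 0 < x^-1 by rewrite invr_gt0.
    apply: eP => //=; rewrite sub0r normrN (gtr0_norm xV0).
    rewrite -[ltRHS]invrK ltf_pV2 ?posrE ?invr_gt0//.
    by near: x; apply: nbhs_pinfty_gt; rewrite num_real.
  exact: powR_cvg0.
- by move=> x Mx; have [] := dF x (lt_trans M0 Mx).
- apply: cvg_at_right_filter.
  apply: differentiable_continuous; apply/derivable1_diffP.
  by have [] := dF M M0.
- move=> x; rewrite in_itv/= andbT => Mx; rewrite derive1E.
  by have [_ ->] := dF x (lt_trans M0 Mx).
Unshelve. all: by end_near.
Qed.

(** The integrand is unbounded at 0, so the fundamental theorem of calculus is
applied on [1/(i+2), 1] and i tends to infinity. *)
Lemma integral_powR_unit_le (a : R) : 0 < a ->
  (\int[mu]_(s in `]0%R, 1%R]) (s `^ (a - 1))%:E <= (a^-1)%:E)%E.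
Proof.
move=> a0.
(* i.+2 rather than i.+1 keeps the interval nondegenerate. *)
pose F i := `[(i.+2%:R)^-1 : R, 1%R]%classic.
have -> : `]0%R, 1%R]%classic = \bigcup_i F i.
  apply/seteqP; split => x /=.
    rewrite in_itv/= => /andP[x0 x1].
    exists (Num.truncn x^-1) => //=; rewrite /F/= in_itv/= x1 andbT.
    rewrite -[leRHS]invrK lef_pV2 ?posrE ?invr_gt0//.
    have := truncnS_gt (x^-1) => /ltW/le_trans; apply.
    by rewrite ler_nat.
  move=> [i _]; rewrite /F/= !in_itv/= => /andP[h ->]; rewrite andbT.
  by apply: lt_le_trans h; rewrite invr_gt0.
have mp i : measurable_fun (F i) (fun s : R => (s `^ (a - 1))%:E).
  by apply/measurable_EFinP; apply: measurable_funTS; exact: measurable_powR.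
have cv : (\int[mu]_(x in F i) (x `^ (a - 1))%:E @[i --> \oo] -->
   \int[mu]_(x in \bigcup_i F i) (x `^ (a - 1))%:E)%E.
  apply: ge0_nondecreasing_set_cvg_integral => //.
  - apply/nondecreasing_seqP => n; rewrite subsetEset => x; rewrite /F/= !in_itv/=.
    move=> /andP[h ->]; rewrite andbT; apply: le_trans h.
    by rewrite lef_pV2 ?posrE// ler_nat.
  - by move=> i; exact: measurable_itv.
  - by move=> i x _; rewrite lee_fin powR_ge0.
rewrite -(cvg_lim _ cv)//.
apply: lime_le; first by apply/cvg_ex; eexists; exact: cv.
apply: nearW => i.
have i0 : 0 < (i.+2%:R : R)^-1 by rewrite invr_gt0.
pose G (s : R) := a^-1 * s `^ a.
have dG (x : R) : 0 < x -> is_derive x 1 G (x `^ (a - 1)).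
  move=> x0; have := is_derive1_powR a x0 => H.
  apply: is_derive_eq.
  by rewrite /GRing.scale/= mulrA mulVf ?gt_eqF// mul1r.
have cG (x : R) : 0 < x -> {for x, continuous G}.
  move=> x0; apply: differentiable_continuous; apply/derivable1_diffP.
  by have [] := dG x x0.
rewrite (@continuous_FTC2 _ _ G).
- rewrite -EFinB lee_fin /G powR1 mulr1 gerBl.
  by rewrite mulr_ge0 ?powR_ge0 ?invr_ge0// ltW.
- by rewrite invf_lt1// ltr1n.
- apply: derivable_within_continuous => x; rewrite in_itv/= => /andP[ix _].
  by apply: derivable_powR; rewrite in_itv/= andbT (lt_le_trans i0 ix).
- split.
  + by move=> x; rewrite in_itv/= => /andP[ix _]; have [] := dG x (lt_trans i0 ix).
  + by apply: cvg_at_right_filter; exact: cG.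
  + by apply: cvg_at_left_filter; exact: cG.
- move=> x; rewrite in_itv/= => /andP[ix _]; rewrite derive1E.
  by have [_ ->] := dG x (lt_trans i0 ix).
Qed.

(** Isolates the two ranges where an integrand that vanishes on ]m, M[ has to be
estimated; for m = M the middle range is empty and this only cuts the half-line
in two. *)
Lemma integral_le_split (m M : R) (h : R -> R) : 0 < m -> 0 < M ->
  measurable_fun (`]0, +oo[ : set R) h -> (forall s, 0 < s -> 0 <= h s) ->
  (forall s, m < s < M -> h s = 0) ->
  (\int[mu]_(s in `]0%R, +oo[) (h s)%:E <=
   \int[mu]_(s in `]0%R, m]) (h s)%:E + \int[mu]_(s in `[M, +oo[) (h s)%:E)%E.
Proof.
move=> m0 M0 mh h0 hz.
have mhE : measurable_fun (`]0, +oo[ : set R) (EFin \o h) by apply/measurable_EFinP.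
have dE : `]0%R, +oo[%classic = `]0, m] `|` `]m, +oo[ :> set R.
  by rewrite -itv_bndbnd_setU// bnd_simp ltW.
rewrite [in leLHS]dE ge0_integral_setU//=; last 3 first.
- by rewrite -dE.
- move=> x; rewrite !in_itv/= andbT lee_fin => H; apply: h0.
  by case: H => [/andP[]|/(lt_trans m0)].
- apply/disj_setPLR => x/=; rewrite !in_itv/= andbT => /andP[_ xm]; apply/negP.
  by rewrite -leNgt.
apply: leeD => //.
rewrite (_ : (\int[mu]_(x in `]m, +oo[) (h x)%:E)%E =
  (\int[mu]_(x in `]m, +oo[ `&` `[M, +oo[) (h x)%:E)%E).
  apply: ge0_subset_integral => //; first exact: measurableI.
  - apply: measurable_funS mhE => // x /=; rewrite !in_itv/= !andbT; lra.
  - by move=> x /=; rewrite in_itv/= andbT lee_fin => xM; apply: h0; lra.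
rewrite integral_mkcondr; apply: eq_integral => x; rewrite inE/= in_itv/= andbT => mx.
rewrite patchE; case: ifPn => //; rewrite notin_setE/= in_itv/= andbT => /negP.
by rewrite -ltNge => xM; rewrite hz// mx.
Qed.

Lemma integral_le_cst (m c : R) (h : R -> R) : 0 < m ->
  measurable_fun (`]0, +oo[ : set R) h -> (forall s, 0 < s -> 0 <= h s) ->
  (forall s, 0 < s <= m -> h s <= c) ->
  (\int[mu]_(s in `]0%R, m]) (h s)%:E <= (c * m)%:E)%E.
Proof.
move=> m0 mh h0 hc.
have -> : ((c * m)%:E = \int[mu]_(s in `]0%R, m]) cst c%:E s)%E.
  by rewrite integral_cst//= lebesgue_measure_itv/= lte_fin m0 oppr0 adde0 EFinM.
apply: ge0_le_integral => //=.
- by move=> s; rewrite in_itv/= => /andP[s0 _]; rewrite lee_fin h0.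
- apply/measurable_EFinP; apply: measurable_funS mh => // s/=.
  by rewrite !in_itv/= andbT => /andP[].
Qed.

Lemma integral_ge_cst (p q c : R) (h : R -> R) : 0 < p -> p < q -> 0 <= c ->
  measurable_fun (`]0, +oo[ : set R) h -> (forall s, 0 < s -> 0 <= h s) ->
  (forall s, p <= s <= q -> c <= h s) ->
  ((c * (q - p))%:E <= \int[mu]_(s in `]0%R, +oo[) (h s)%:E)%E.
Proof.
move=> p0 pq c0 mh h0 hc.
have sub : (`[p, q] : set R) `<=` `]0, +oo[.
  by move=> s/=; rewrite !in_itv/= andbT => /andP[ps _]; apply: lt_le_trans ps.
apply: (@le_trans _ _ (\int[mu]_(s in `[p, q]) (h s)%:E)%E); last first.
  apply: ge0_subset_integral => //; first exact/measurable_EFinP.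
  by move=> s/=; rewrite in_itv/= andbT lee_fin; exact: h0.
have -> : ((c * (q - p))%:E = \int[mu]_(s in `[p, q]) cst c%:E s)%E.
  by rewrite integral_cst//= lebesgue_measure_itv/= lte_fin pq EFinM EFinB.
apply: ge0_le_integral => //=.
- by apply/measurable_EFinP; apply: measurable_funS mh.
Qed.

(** The real-valued integral is 0 when the extended one is infinite, so bounds
transfer to it only when both sides are controlled. *)
Lemma fine_bounds (x : \bar R) (a b : R) :
  (a%:E <= x <= b%:E)%E -> a <= fine x <= b.
Proof. by case: x => [r||] //=; rewrite ?lee_fin// => /andP[]. Qed.

(** Near 0 the integrand is at most x^(alpha-1), beyond 1 it is at most
x^(alpha-2) because e^(-x) <= 1/x, and on [1, 2] it is bounded below. *)
Lemma Gamma_gt0 (alpha : R) : 0 < alpha < 1 -> 0 < Gamma alpha.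
Proof.
move=> /andP[alpha_gt0 alpha_lt1].
pose h (x : R) := x `^ (alpha - 1) * expR (- x).
have mh : measurable_fun (`]0, +oo[ : set R) h.
  apply: measurable_funTS; apply: measurable_funM; first exact: measurable_powR.
  by apply: measurableT_comp => //; exact: measurableT_comp.
have h0 s : 0 < s -> 0 <= h s by move=> _; rewrite mulr_ge0 ?powR_ge0 ?expR_ge0.
have lo : ((expR (-2) / 2 * (2 - 1))%:E <= \int[mu]_(s in `]0%R, +oo[) (h s)%:E)%E.
  apply: integral_ge_cst => //; first by rewrite ltr1n.
  move=> s /andP[s1 s2]; rewrite /h mulrC; apply: ler_pM.
  - by rewrite invr_ge0.
  - exact: expR_ge0.
  - have s0 : 0 < s by lra.
    apply: (@le_trans _ _ (s `^ (-1))); last by apply: ler_powR => //; lra.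
    by rewrite powR_inv1 ?lef_pV2 ?posrE//; lra.
  - by rewrite ler_expR lerN2.
have hi : (\int[mu]_(s in `]0%R, +oo[) (h s)%:E <=
    (alpha^-1 + 1 `^ (- (1 - alpha)) / (1 - alpha))%:E)%E.
  apply: le_trans (@integral_le_split 1 1 _ _ _ mh h0 _) _ => //.
    by move=> s /andP[s1 s2]; lra.
  rewrite EFinD; apply: leeD.
    apply: le_trans (integral_powR_unit_le _ alpha_gt0).
    apply: ge0_le_integral => //=.
    - by move=> s; rewrite in_itv/= => /andP[s0 _]; rewrite lee_fin h0.
    - apply/measurable_EFinP; apply: measurable_funS mh => // s/=.
      by rewrite !in_itv/= andbT => /andP[].
    - by apply/measurable_EFinP; apply: measurable_funTS; exact: measurable_powR.
    - move=> s; rewrite in_itv/= => /andP[s0 _]; rewrite lee_fin.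
      by rewrite ler_piMr ?powR_ge0// -expR0 ler_expR oppr_le0 ltW.
  rewrite -integral_powR_tail//; last by lra.
  apply: ge0_le_integral => //=.
  - move=> s; rewrite in_itv/= andbT => s1; rewrite lee_fin h0//; lra.
  - apply/measurable_EFinP; apply: measurable_funS mh => // s/=.
    by rewrite !in_itv/= !andbT; lra.
  - by apply/measurable_EFinP; apply: measurable_funTS; exact: measurable_powR.
  - move=> s; rewrite in_itv/= andbT => s1; rewrite lee_fin.
    have s0 : 0 < s by lra.
    have -> : - (1 + (1 - alpha)) = (alpha - 1) + (-1) by lra.
    rewrite powRD; last by rewrite (gt_eqF s0) implybT.
    rewrite ler_wpM2l ?powR_ge0// (powR_inv1 (ltW s0)) expRN.
    rewrite lef_pV2 ?posrE ?expR_gt0//.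
    by have := expR_ge1Dx s; lra.
have /fine_bounds/andP[+ _] : ((expR (-2) / 2 * (2 - 1))%:E <=
    \int[mu]_(s in `]0%R, +oo[) (h s)%:E <=
    (alpha^-1 + 1 `^ (- (1 - alpha)) / (1 - alpha))%:E)%E by rewrite lo hi.
apply: lt_le_trans.
by rewrite mulr_gt0 ?divr_gt0 ?expR_gt0//; lra.
Qed.

(** * Bounds on the fractional Poisson operator *)

(** For g supported away from ]m, M[, the part below m is controlled by the bound
32 / tau^2 on the kernel, the part beyond M by its power tail. The case m = M
also shows that the kernel is integrable. *)
Lemma kernel_integral_le (alpha tau m M : R) (g : R -> R) :
  0 < alpha < 1 -> 0 < tau -> 0 < m <= tau ^+ 2 -> 0 < M ->
  measurable_fun setT g -> (forall s, 0 <= g s <= 1) ->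
  (forall s, m < s < M -> g s = 0) ->
  (\int[mu]_(s in `]0%R, +oo[) (poisson_kernel alpha tau s * g s)%:E <=
   (32 * (m / tau ^+ 2) + tau `^ (2 * alpha) * (M `^ (- alpha) / alpha))%:E)%E.
Proof.
move=> /andP[a0 a1] t0 /andP[m0 mt] M0 mg g01 gz.
have t20 : 0 < tau ^+ 2 by rewrite exprn_gt0.
have mh : measurable_fun (`]0, +oo[ : set R) (fun s => poisson_kernel alpha tau s * g s).
  by apply: measurable_funM; [exact: measurable_poisson_kernel|exact: measurable_funTS].
have h0 s : 0 < s -> 0 <= poisson_kernel alpha tau s * g s.
  by move=> _; rewrite mulr_ge0 ?poisson_kernel_ge0//; have /andP[] := g01 s.
have hK s : poisson_kernel alpha tau s * g s <= poisson_kernel alpha tau s.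
  by rewrite ler_piMr ?poisson_kernel_ge0//; have /andP[] := g01 s.
apply: le_trans (@integral_le_split m M _ _ _ mh h0 _) _ => //.
  by move=> s sm; rewrite gz ?mulr0.
rewrite EFinD; apply: leeD.
  have -> : 32 * (m / tau ^+ 2) = 32 / tau ^+ 2 * m by field; lra.
  apply: integral_le_cst => // s /andP[s0 sm].
  apply: le_trans (hK s) _; apply: poisson_kernel_le_near => //; lra.
rewrite EFinM -integral_powR_tail// -ge0_integralZl_EFin//=; last 3 first.
- by move=> x _; rewrite lee_fin powR_ge0.
- by apply/measurable_EFinP; apply: measurable_funTS; exact: measurable_powR.
- exact: powR_ge0.
apply: ge0_le_integral => //=.
- by move=> s; rewrite in_itv/= andbT => s1; rewrite lee_fin h0//; lra.
- apply/measurable_EFinP; apply: measurable_funS mh => // s/=.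
  by rewrite !in_itv/= !andbT; lra.
- apply: measurable_funeM; apply/measurable_EFinP; apply: measurable_funTS.
  exact: measurable_powR.
- move=> s; rewrite in_itv/= andbT => s1; rewrite -EFinM lee_fin.
  by apply: le_trans (hK s) _; apply: poisson_kernel_le_far; lra.
Qed.

Lemma frac_poisson_le (alpha tau m M t : R) (f : R -> R) :
  0 < alpha < 1 -> 0 < tau -> 0 < m <= tau ^+ 2 -> 0 < M ->
  measurable_fun setT f -> (forall x, 0 <= f x <= 1) ->
  (forall s, m < s < M -> f (t - s) = 0) ->
  frac_poisson alpha tau f t <= (4 `^ alpha * Gamma alpha)^-1 *
    (32 * (m / tau ^+ 2) + tau `^ (2 * alpha) * (M `^ (- alpha) / alpha)).
Proof.
move=> a01 t0 m0 M0 mf f01 fz.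
have mg : measurable_fun setT (fun s : R => f (t - s)).
  by apply: measurableT_comp => //; apply: measurable_funB.
rewrite /frac_poisson ler_wpM2l//.
  by rewrite invr_ge0 mulr_ge0 ?powR_ge0// ltW// Gamma_gt0.
have H := kernel_integral_le _ _ _ _ _ a01 t0 m0 M0 mg (fun s => f01 _) fz.
suff /fine_bounds/andP[] : (0%:E <= \int[mu]_(s in `]0%R, +oo[)
  (poisson_kernel alpha tau s * f (t - s))%:E <=
  (32 * (m / tau ^+ 2) + tau `^ (2 * alpha) * (M `^ (- alpha) / alpha))%:E)%E by [].
rewrite H andbT; apply: integral_ge0 => s _.
by rewrite lee_fin mulr_ge0 ?poisson_kernel_ge0//; have /andP[] := f01 (t - s).
Qed.

Lemma frac_poisson_ge (alpha tau t : R) (f : R -> R) :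
  0 < alpha < 1 -> 0 < tau ->
  measurable_fun setT f -> (forall x, 0 <= f x <= 1) ->
  (forall s, tau ^+ 2 <= s <= 2 * tau ^+ 2 -> f (t - s) = 1) ->
  (4 `^ alpha * Gamma alpha)^-1 * (expR (- 4^-1) / 4) <= frac_poisson alpha tau f t.
Proof.
move=> a01 t0 mf f01 f1; have /andP[a0 a1] := a01.
have t20 : 0 < tau ^+ 2 by rewrite exprn_gt0.
have mg : measurable_fun setT (fun s : R => f (t - s)).
  by apply: measurableT_comp => //; apply: measurable_funB.
rewrite /frac_poisson ler_wpM2l//.
  by rewrite invr_ge0 mulr_ge0 ?powR_ge0// ltW// Gamma_gt0.
have m0 : 0 < tau ^+ 2 <= tau ^+ 2 by rewrite t20/=.
(* With an empty middle range, the upper bound gives finiteness of the integral. *)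
have hi := kernel_integral_le _ _ _ _ _ a01 t0 m0 t20 mg (fun s => f01 _).
suff lo : ((expR (- 4^-1) / 4)%:E <= \int[mu]_(s in `]0%R, +oo[)
  (poisson_kernel alpha tau s * f (t - s))%:E)%E.
  have empty s : tau ^+ 2 < s < tau ^+ 2 -> f (t - s) = 0.
    by move=> /andP[s1 s2]; lra.
  by have /andP[] := fine_bounds _ _ _ (introT andP (conj lo (hi empty))).
have -> : expR (- 4^-1) / 4 = expR (- 4^-1) / 4 / tau ^+ 2 *
  (2 * tau ^+ 2 - tau ^+ 2) :> R.
  by field; lra.
apply: integral_ge_cst => //.
- by lra.
- by rewrite !mulr_ge0 ?expR_ge0 ?invr_ge0// ltW.
- by apply: measurable_funM; [exact: measurable_poisson_kernel|exact: measurable_funTS].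
- by move=> s _; rewrite mulr_ge0 ?poisson_kernel_ge0//; have /andP[] := f01 (t - s).
- by move=> s st; rewrite f1// mulr1; apply: poisson_kernel_ge.
Qed.

End integrals.

(** * The oscillating function *)

(** The blocks are strictly larger than [-2 q, -q], q = r^(4k), which is what the
kernel at scale r^(2k) sees from the origin: the margin leaves room for a
translation by any t that is small compared with q. *)
Definition blocks {R : realType} (r : R) : set R :=
  \bigcup_(k : nat) `]- (4 * (r ^+ k.*2) ^+ 2), - ((r ^+ k.*2) ^+ 2 / 2)[%classic.

Lemma measurable_blocks (R : realType) (r : R) : measurable (blocks r).
Proof. by apply: bigcup_measurable => k _; exact: measurable_itv. Qed.

Lemma indic_in01 (T : Type) (R : realType) (A : set T) (x : T) :
  0 <= (\1_A x : R) <= 1.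
Proof. by rewrite indicE; case: (x \in A); rewrite ?lexx ler01. Qed.

Lemma indic_blocks_even (R : realType) (r t : R) (n : nat) : 0 < r -> ~~ odd n ->
  2 * `|t| < (r ^+ n) ^+ 2 ->
  forall s, (r ^+ n) ^+ 2 <= s <= 2 * (r ^+ n) ^+ 2 -> \1_(blocks r) (t - s) = 1 :> R.
Proof.
move=> r0 en ht s /andP[s1 s2]; rewrite indicE mem_set//.
exists n./2 => //=; rewrite in_itv/= even_halfK//.
have := ler_norm t; have := ler_norm (- t); rewrite normrN => h1 h2.
apply/andP; split; lra.
Qed.

(** The two blocks adjacent to the odd index n are at distances of order
r^(2n) / r^2 and r^2 r^(2n). *)
Lemma indic_blocks_odd (R : realType) (r t : R) (n : nat) : 4 <= r -> odd n ->
  r ^+ 2 * `|t| <= (r ^+ n) ^+ 2 ->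
  forall s, 5 * (r ^+ n) ^+ 2 / r ^+ 2 < s < r ^+ 2 * (r ^+ n) ^+ 2 / 4 ->
  \1_(blocks r) (t - s) = 0 :> R.
Proof.
move=> r4 on ht s /andP[s1 s2]; rewrite indicE memNset// => -[k _] /=.
rewrite in_itv/= => /andP[k1 k2].
have := ler_norm t; have := ler_norm (- t); rewrite normrN => h1 h2.
have r1 : 1 <= r by lra.
have r20 : 0 < r ^+ 2 by rewrite exprn_gt0; lra.
have r2 : 16 <= r ^+ 2.
  have -> : 16 = 4 ^+ 2 :> R by rewrite -natrX.
  by rewrite lerXn2r ?nnegrE; lra.
have tle : `|t| <= (r ^+ n) ^+ 2 / r ^+ 2 by rewrite ler_pdivlMr// mulrC.
have s1' : 5 * ((r ^+ n) ^+ 2 / r ^+ 2) < s by rewrite mulrA.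
case: (ltnP k.*2 n) => kn.
- have : (r ^+ k.*2) ^+ 2 <= (r ^+ n) ^+ 2 / r ^+ 2.
    rewrite ler_pdivlMr// -exprMn -exprSr -!exprM.
    by apply: ler_weXn2l => //; rewrite leq_mul2r.
  by move=> h; lra.
- have kn' : (n.+1 <= k.*2)%N.
    by rewrite ltn_neqAle kn andbT; apply/eqP => e; move: on; rewrite e odd_double.
  have : r ^+ 2 * (r ^+ n) ^+ 2 <= (r ^+ k.*2) ^+ 2.
    rewrite -exprMn -exprS -!exprM.
    by apply: ler_weXn2l => //; rewrite leq_mul2r.
  have : 16 * `|t| <= r ^+ 2 * `|t| by rewrite ler_wpM2r.
  have : 16 * (r ^+ n) ^+ 2 <= r ^+ 2 * (r ^+ n) ^+ 2 by rewrite ler_wpM2r ?sqr_ge0.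
  by move=> h3 h4 h5; lra.
Qed.

Lemma indic_in_Lfun_oo (R : realType) (A : set R) : measurable A ->
  \1_A \in Lfun (@lebesgue_measure R) +oo%E.
Proof.
move=> mA; rewrite inE; apply/andP; split.
  by rewrite inE; exact: measurable_indic.
rewrite inE /= /finite_norm unlock /Lnorm.
case: ifPn => [_|//]; apply: (@le_lt_trans _ _ 1%:E); last exact: ltry.
apply/ess_supP; apply: nearW => x /=.
by rewrite lee_fin ger0_norm; have /andP[] := @indic_in01 _ R A x.
Qed.

(** The sum bounds the mass that the kernel at any scale tau gives to the
complement of ]5 tau^2 / r^2, r^2 tau^2 / 4[. *)
Lemma exists_large_ratio (R : realType) (alpha c : R) : 0 < alpha -> 0 < c ->
  exists r : R, 4 <= r /\ 32 * (5 / r ^+ 2) + (r ^+ 2 / 4) `^ (- alpha) / alpha <= c.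
Proof.
move=> a0 c0.
(* The summand 320 / c makes the first term at most c / 2; x solves
   x ^ (- alpha) / alpha = c / 2 and makes the second one so. *)
pose x := (2 / (c * alpha)) `^ alpha^-1.
have x0 : 0 < x by rewrite powR_gt0// divr_gt0// mulr_gt0.
have y0 : 0 < 320 / c by rewrite divr_gt0.
exists (4 + 320 / c + x); split; first by lra.
set r := 4 + 320 / c + x.
have r4 : 4 <= r by rewrite /r; lra.
have r0 : 0 < r by lra.
have rr : 4 * r <= r ^+ 2 by rewrite expr2 ler_wpM2r// ltW.
have r20 : 0 < r ^+ 2 by rewrite exprn_gt0.
have h1 : 32 * (5 / r ^+ 2) <= c / 2.
  rewrite mulrA ler_pdivrMr//.
  apply: (@le_trans _ _ (c / 2 * (320 / c))); last first.
    by rewrite ler_wpM2l ?divr_ge0 ?ltW//; rewrite /r in rr *; lra.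
  have -> : c / 2 * (320 / c) = 160 by field; lra.
  lra.
have h2 : (r ^+ 2 / 4) `^ (- alpha) / alpha <= c / 2.
  rewrite powRN ler_pdivrMr// -[leRHS]invrK.
  rewrite lef_pV2 ?posrE ?invr_gt0 ?powR_gt0//; [|lra|]; last first.
    by rewrite mulr_gt0// divr_gt0.
  apply: (@le_trans _ _ (x `^ alpha)).
    rewrite /x -powRrM mulVf ?gt_eqF// powRr1.
      by rewrite le_eqVlt; apply/orP; left; apply/eqP; field; lra.
    by rewrite divr_ge0// mulr_ge0// ltW.
  apply: ge0_ler_powR; rewrite ?nnegrE; rewrite ?ltW//; try lra.
  rewrite /r in rr *; lra.
lra.
Qed.

(** * Divergence of the alternating sums *)

Lemma ler_nat_sqr_expr (R : realType) (r : R) (n : nat) : 2 <= r ->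
  n%:R <= (r ^+ n) ^+ 2.
Proof.
move=> r2.
have h : n%:R <= r ^+ n.
  apply: (@le_trans _ _ (2 ^+ n)).
    by rewrite -natrX ler_nat ltnW// ltn_expl.
  by rewrite lerXn2r ?nnegrE//; lra.
apply: le_trans h _; rewrite expr2 ler_peMr ?exprn_ge0//; first lra.
by rewrite exprn_ege1//; lra.
Qed.

Lemma poisson_blocks_even (R : realType) (alpha r t : R) (n : nat) :
  0 < alpha < 1 -> 0 < r -> ~~ odd n -> 2 * `|t| < (r ^+ n) ^+ 2 ->
  (4 `^ alpha * Gamma alpha)^-1 * (expR (- 4^-1) / 4)
  <= frac_poisson alpha (r ^+ n) \1_(blocks r) t.
Proof.
move=> a01 r0 en tn.
apply: frac_poisson_ge => //; first exact: exprn_gt0.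
- apply: measurable_indic; exact: measurable_blocks.
- exact: indic_in01.
- exact: indic_blocks_even.
Qed.

Lemma poisson_blocks_odd (R : realType) (alpha r t : R) (n : nat) :
  0 < alpha < 1 -> 4 <= r -> odd n -> r ^+ 2 * `|t| <= (r ^+ n) ^+ 2 ->
  frac_poisson alpha (r ^+ n) \1_(blocks r) t <=
  (4 `^ alpha * Gamma alpha)^-1 *
    (32 * (5 / r ^+ 2) + (r ^+ 2 / 4) `^ (- alpha) / alpha).
Proof.
move=> a01 r4 on tn.
have r0 : 0 < r by lra.
have tau0 : 0 < r ^+ n by rewrite exprn_gt0.
have q0 : 0 < (r ^+ n) ^+ 2 by rewrite exprn_gt0.
have r20 : 0 < r ^+ 2 by rewrite exprn_gt0.
have r25 : 5 <= r ^+ 2.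
  by apply: (@le_trans _ _ (4 * r)); [lra|rewrite expr2 ler_wpM2r// ltW].
have m0 : 0 < 5 * (r ^+ n) ^+ 2 / r ^+ 2 <= (r ^+ n) ^+ 2.
  rewrite divr_gt0 ?mulr_gt0//= ler_pdivrMr// mulrC.
  by rewrite ler_wpM2l// ltW.
have M0 : 0 < r ^+ 2 * (r ^+ n) ^+ 2 / 4 by rewrite divr_gt0// mulr_gt0.
apply: (le_trans (frac_poisson_le _ _ _ _ _ _ a01 tau0 m0 M0 _ _ _)).
- apply: measurable_indic; exact: measurable_blocks.
- exact: indic_in01.
- exact: indic_blocks_odd.
rewrite ler_wpM2l//.
  by rewrite invr_ge0 mulr_ge0 ?powR_ge0// ltW// Gamma_gt0.
have -> : 5 * (r ^+ n) ^+ 2 / r ^+ 2 / (r ^+ n) ^+ 2 = 5 / r ^+ 2 by field; lra.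
rewrite lerD2l// mulrA ler_wpM2r//.
  by rewrite invr_ge0; lra.
have -> : r ^+ 2 * (r ^+ n) ^+ 2 / 4 = r ^+ 2 / 4 * (r ^+ n) ^+ 2 by lra.
rewrite powRM ?divr_ge0 ?(ltW q0) ?(ltW r20)// powRN powRrM powR_mulrn ?(ltW tau0)//.
rewrite (powRN (_ ^+ 2)) mulrCA divff ?mulr1 ?lt0r_neq0 ?powR_gt0//.
Qed.

Theorem theorem1p3 (R : realType) (alpha : R) (halpha0 : 0 < alpha)
    (halpha1 : alpha < 1) :
  exists (v a : int -> R) (rho : R) (f : R -> R),
    [/\ bounded_fun v,
        1 < rho,
        lacunary rho a,
        f \in Lfun (@lebesgue_measure R) +oo%E &
        forall t : R, max_diff_transform alpha v a f t = +oo%E].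
Proof.
have a01 : 0 < alpha < 1 by rewrite halpha0.
set c0 : R := expR (- 4^-1) / 4.
have c0_gt0 : 0 < c0 by rewrite divr_gt0 ?expR_gt0.
set C := (4 `^ alpha * Gamma alpha)^-1.
have C_gt0 : 0 < C by rewrite invr_gt0 mulr_gt0 ?powR_gt0 ?Gamma_gt0.
have [r [r4 rc]] := exists_large_ratio R alpha (c0 / 2) halpha0
  (divr_gt0 c0_gt0 (ltr0Sn _ 1)).
have r0 : 0 < r by lra.
exists (fun j => (-1) ^+ `|j|.+1), (fun j => r ^ j), r, \1_(blocks r); split.
- exists 1; split => // M M1 j _ /=.
  by rewrite normrX normrN1 expr1n ltW.
- lra.
- split => j; first by rewrite exprz_gt0.
  by rewrite expfzDr ?gt_eqF// expr1z mulrC mulKf ?expfz_neq0 ?gt_eqF.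
- apply: indic_in_Lfun_oo; exact: measurable_blocks.
move=> t; apply/eqyP => A A0.
(* Past J, the translation by t is small compared with (r ^ n) ^ 2. *)
pose J := (Num.truncn (r ^+ 2 * `|t|)).+1.
have r2_16 : 2 < r ^+ 2.
  by apply: (@lt_le_trans _ _ (4 * r)); [lra|rewrite expr2 ler_wpM2r// ltW].
have large n : (J <= n)%N -> r ^+ 2 * `|t| < (r ^+ n) ^+ 2.
  move=> Jn; apply: lt_le_trans (truncnS_gt _) _.
  apply: le_trans (ler_nat_sqr_expr _ _ n _); last lra.
  by rewrite ler_nat.
pose P n := frac_poisson alpha (r ^+ n) \1_(blocks r) t.
have Pe n : (J <= n)%N -> ~~ odd n -> C * c0 <= P n.
  move=> Jn en; apply: poisson_blocks_even => //.
  apply: le_lt_trans (large n Jn).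
  by rewrite ler_wpM2r// ltW.
have Po n : (J <= n)%N -> odd n -> P n <= C * (c0 / 2).
  move=> Jn on; apply: le_trans (ler_wpM2l (ltW C_gt0) rc).
  by apply: poisson_blocks_odd => //; exact/ltW/large.
have term n : (J <= n)%N -> C * (c0 / 2) <= (-1) ^+ n.+1 * (P n.+1 - P n).
  move=> Jn; rewrite -signr_odd /=; have Jn1 := leqW Jn.
  have [on|en] := boolP (odd n) => /=.
    by have := Pe n.+1 Jn1; have := Po n Jn on; rewrite /= on expr0 => h /(_ isT); lra.
  by have := Po n.+1 Jn1; have := Pe n Jn en; rewrite /= en expr1 => h /(_ isT); lra.
pose n := (Num.truncn (A / (C * (c0 / 2)))).+1.
have d0 : 0 < C * (c0 / 2) by rewrite mulr_gt0// divr_gt0.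
apply: le_ereal_sup_tmp.
exists (`|diff_transform alpha (fun j => (-1) ^+ `|j|.+1) (fun j => r ^ j)
   (J%:Z, (J + n)%:Z) \1_(blocks r) t|)%:E.
  by exists (J%:Z, (J + n)%:Z) => //=; rewrite ltz_nat -addn1 leq_add2l.
rewrite lee_fin; apply: le_trans (ler_norm _).
rewrite /diff_transform /=.
have -> : `|((J + n)%N%:Z - J%:Z)%R|%N = n by rewrite PoszD addrC addKr.
apply: (@le_trans _ _ (\sum_(0 <= k < n.+1) C * (c0 / 2))).
  rewrite sumr_const_nat subn0 -[leRHS]mulr_natr mulrC -ler_pdivrMr//.
  apply: le_trans (ltW (truncnS_gt _)) _.
  by rewrite ler_nat leqnSn.
apply: ler_sum_nat => k _.
have -> : J%:Z + k%:Z = (J + k)%N%:Z by rewrite PoszD.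
have -> : (J + k)%N%:Z + 1 = (J + k).+1%:Z by rewrite -addn1 PoszD.
by apply: term; exact: leq_addr.
Qed.
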